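(* Let $\Omega$ be a bounded open subset of $\mathbb{R}^n$, and let $B^{(1)},\dots,B^{(n)}$ and $C$ be real $m\times m$ matrices with constant entries. Assume that there exists an invertible real $m\times m$ matrix $Q$ such that: (1) for all $i=1,\dots,n$, $Q^{-1}B^{(i)}Q=\mathrm{Diag}\big(\beta^{(i)}_1,\dots,\beta^{(i)}_m\big)$ for some $\beta^{(i)}_j\in\mathbb{R}$, $j=1,\dots,m$; (2) $Q^{-1}\ge 0$; (3) the matrix $Q^{-1}CQ$ is cooperative. Then the convex cone $S=\{u\in\mathbb{R}^m:\ Q^{-1}u\le 0\}$ is invariant for the system $$Au+\sum_{i=1}^n B^{(i)}D_iu+Cu\ge 0\quad\text{in }\Omega .$$
   Context: For a vector-valued function $u=(u_1,\dots,u_m)$ on $\Omega\subset\mathbb{R}^n$, $Au=(\Delta u_1,\dots,\Delta u_m)^T$ and $D_iu=\big(\frac{\partial u_1}{\partial x_i},\dots,\frac{\partial u_m}{\partial x_i}\big)^T$. Inequalities between vectors are componentwise ($w\le 0$ means $w_j\le 0$ for all $j$, and similarly for $\ge$), and for a real matrix $M$, $M\ge 0$ means that all its entries are nonnegative. A real $m\times m$ matrix $M=(m_{jk})$ is cooperative if $m_{jk}\ge 0$ for all $j\ne k$ and $\sum_{k=1}^m m_{jk}\le 0$ for every $j=1,\dots,m$. A set $S\subseteq\mathbb{R}^m$ is invariant for the system if every $u\in[C^2(\Omega)]^m\cap[C^0(\overline\Omega)]^m$ satisfying the system of inequalities in $\Omega$ has the property: if $u(x)\in S$ for all $x\in\partial\Omega$,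 then $u(x)\in S$ for all $x\in\Omega$. *)

(* Defs.v *)
From mathcomp Require Import all_boot all_order all_algebra.
From mathcomp Require Import all_classical all_reals all_analysis.

Set Implicit Arguments.
Unset Strict Implicit.
Unset Printing Implicit Defensive.
Import Order.TTheory GRing.Theory Num.Theory numFieldNormedType.Exports.
Local Open Scope classical_set_scope.
Local Open Scope ring_scope.

(* Points of the domain R^n are row vectors; values in R^m are column vectors,
   so that m x m matrices act on them by left multiplication. *)

Definition mxle (R : realType) (p q : nat) (M N : 'M[R]_(p, q)) : Prop :=
  forall i j, M i j <= N i j.

Definition cooperative (R : realType) (m : nat) (M : 'M[R]_m) : Prop :=
  (forall j k, j != k -> 0 <= M j k) /\ (forall j, \sum_k M j k <= 0).

Definition boundary (T : topologicalType) (A : set T) : set T :=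
  closure A `\` interior A.

Definition partial (R : realType) (n : nat) (i : 'I_n) (f : 'rV[R]_n -> R)
  : 'rV[R]_n -> R := 'D_(delta_mx 0 i) f.

(* All partial derivatives of f of order at most k exist and are continuous at
   every point of A. Meant for A open, where the values of f outside A are
   irrelevant. *)
Fixpoint class_C (R : realType) (n k : nat) (A : set 'rV[R]_n)
    (f : 'rV[R]_n -> R) : Prop :=
  (forall x, A x -> {for x, continuous f}) /\
  if k is k'.+1 then
    forall i : 'I_n, (forall x, A x -> derivable f x (delta_mx 0 i)) /\
                     class_C k' A (partial i f)
  else True.

Definition vcomp (R : realType) (n m : nat) (u : 'rV[R]_n -> 'cV[R]_m)
  (j : 'I_m) : 'rV[R]_n -> R := fun x => u x j 0.

Definition laplacian (R : realType) (n : nat) (f : 'rV[R]_n -> R)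
  : 'rV[R]_n -> R := fun x => \sum_(i < n) partial i (partial i f) x.

Definition vlaplacian (R : realType) (n m : nat) (u : 'rV[R]_n -> 'cV[R]_m)
  : 'rV[R]_n -> 'cV[R]_m := fun x => \col_j laplacian (vcomp u j) x.

Definition vpartial (R : realType) (n m : nat) (i : 'I_n)
  (u : 'rV[R]_n -> 'cV[R]_m) : 'rV[R]_n -> 'cV[R]_m :=
  fun x => \col_j partial i (vcomp u j) x.

Definition solves_system (R : realType) (n m : nat) (Omega : set 'rV[R]_n)
    (B : 'I_n -> 'M[R]_m) (C : 'M[R]_m) (u : 'rV[R]_n -> 'cV[R]_m) : Prop :=
  forall x, Omega x ->
    mxle 0 (vlaplacian u x + \sum_(i < n) B i *m vpartial i u x + C *m u x).

(* Functions on the closure of Omega are represented by total functions; every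
   condition below only depends on their values on the closure of Omega when
   Omega is open. *)
Definition invariant_set (R : realType) (n m : nat) (Omega : set 'rV[R]_n)
    (sys : ('rV[R]_n -> 'cV[R]_m) -> Prop) (S : set 'cV[R]_m) : Prop :=
  forall u : 'rV[R]_n -> 'cV[R]_m,
    (forall j, class_C 2 Omega (vcomp u j)) ->
    (forall j, {within closure Omega, continuous (vcomp u j)}) ->
    sys u ->
    (forall x, boundary Omega x -> S (u x)) ->
    forall x, Omega x -> S (u x).

(* Main.v *)
Require Import Defs.
From mathcomp Require Import all_boot all_order all_algebra.
From mathcomp Require Import all_classical all_reals all_analysis.
From mathcomp Require Import ring lra.
Set Implicit Arguments.
Unset Strict Implicit.
Unset Printing Implicit Defensive.
Import Order.TTheory GRing.Theory Num.Theory numFieldNormedType.Exports.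
Local Open Scope classical_set_scope.
Local Open Scope ring_scope.

(** The change of unknowns v = Q^-1 u turns the cone S into the negative orthant
    and decouples the first-order terms. Since Q^-1 is nonnegative, it may be
    applied to the system of inequalities, which gives for every j
      Delta v_j + sum_i beta^(i)_j D_i v_j + sum_k H_jk v_k >= 0,
    where H = Q^-1 C Q is cooperative ([conjugated_system]). It remains to see
    that such a v is nonpositive in Omega as soon as it is nonpositive on the
    boundary ([cooperative_maximum_principle]).

    Suppose first that the inequalities are strict, and let (j, x) maximize
    v_j(x) over all components and all points of the compact closure of Omega.
    If the maximum is positive, then x is an interior point, so D_i v_j(x) = 0
    and D_ii v_j(x) <= 0. Moreover v_k(x) <= v_j(x) for all k, so cooperativity
    gives sum_k H_jk v_k(x) <= v_j(x) sum_k H_jk <= 0, which contradicts the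
    strict inequality ([strict_cooperative_maximum_principle]).

    The general case follows by adding e (phi - K) to every component, where
    e > 0, phi(x) = exp(lam x_0) and K is the maximum of phi on the closure.
    For lam large, Delta phi + sum_i beta^(i)_j D_i phi
    = lam (lam + beta^(0)_j) phi > 0. Because phi - K is nonpositive and the row
    sums of H are nonpositive, the zero-order terms keep the right sign and the
    boundary condition survives. Finally e tends to 0.

    Derivatives are handled through explicitly given functions df and d2f
    rather than through iterated derivative operators: the
    perturbed and linearly combined unknowns then need no argument that two
    functions which agree near a point have the same derivatives there. *)

(** * Second-derivative test along a direction *)

(** Reduces directional derivatives to derivatives of functions of one real
    variable, where Rolle-type theorems and the chain rule apply. *)
Lemma is_derive_line (R : realType) (V : normedModType R) (f : V -> R)
    (x v : V) (t d : R) :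
  is_derive (t *: v + x) v f d <->
  is_derive t (1 : R) (fun s : R => f (s *: v + x)) d.
Proof.
have E : (fun h : R => h^-1 *:
             (((fun s : R => f (s *: v + x)) \o shift t) (h *: 1)
              - f (t *: v + x))) =
         (fun h => h^-1 *:
             ((f \o shift (t *: v + x)) (h *: v) - f (t *: v + x))).
  by apply/funext => h /=; rewrite [_%:A]mulr1 scalerDl addrA.
by split=> -[df fd]; split; rewrite -?fd /derivable /derive ?E // -E.
Qed.

(** If d2 were positive, the difference quotient of df at its zero 0 would make
    df positive just to the right of 0, and the mean value theorem would give f
    a value above f 0. *)
Lemma second_derivative_test (R : realType) (f df : R -> R) (e d2 : R) :
  0 < e ->
  (forall t : R, `|t| < e -> is_derive t (1 : R) f (df t)) ->
  is_derive (0 : R) (1 : R) df d2 ->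
  (forall t : R, `|t| < e -> f t <= f 0) ->
  df 0 = 0 /\ d2 <= 0.
Proof.
move=> e0 fdf dfd2 f0.
have df0 : df 0 = 0.
  have : is_derive (0 : R) (1 : R) f 0.
    apply: (@derive1_at_max _ f (- e) e) => [|t||t]; rewrite ?in_itv /=.
    - lra.
    - by rewrite -ltr_norml => /fdf[].
    - by rewrite oppr_lt0 e0.
    - by rewrite -ltr_norml => /f0.
  have [_ <-] : is_derive (0 : R) (1 : R) f (df 0).
    by apply: fdf; rewrite normr0.
  by case.
split=> //; rewrite leNgt; apply/negP => d2_gt0.
have [ddf d2E] := dfd2.
have : h^-1 *: ((df \o shift 0) (h *: 1) - df 0) @[h --> 0^'] --> d2.
  by rewrite -d2E.
move/cvgr_gt => /(_ _ d2_gt0)[r /= r0 rP].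
pose c := Num.min e r / 2.
have m0 : 0 < Num.min e r by rewrite lt_min e0.
have me : Num.min e r <= e by rewrite ge_min lexx.
have mr : Num.min e r <= r by rewrite ge_min lexx orbT.
have [c0 ce cr] : [/\ 0 < c, c < e & c < r] by rewrite /c; split; lra.
have [t|t|t] := @MVT _ f df 0 c c0.
- rewrite in_itv /= => /andP[t0 tc]; apply: fdf.
  by rewrite gtr0_norm//; lra.
- move: t; apply: derivable_within_continuous => t.
  rewrite in_itv /= => /andP[t0 tc].
  have [] // : is_derive t (1 : R) f (df t).
  by apply: fdf; rewrite ger0_norm//; lra.
rewrite in_itv /= => /andP[t0 tc] E.
have := rP t; rewrite /ball_ /= sub0r normrN gtr0_norm//.
move=> /(_ (lt_trans tc cr) (lt0r_neq0 t0)).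
rewrite addr0 df0 subr0 [_%:A]mulr1 [_ *: _]/(_ * _).
rewrite pmulr_rgt0 ?invr_gt0// => dft.
have := f0 c; rewrite gtr0_norm// => /(_ ce).
by rewrite -subr_le0 E subr0 leNgt mulr_gt0.
Qed.

Lemma directional_second_derivative_test (R : realType) (V : normedModType R)
    (A : set V) (f df : V -> R) (x v : V) (d2 : R) :
  open A -> A x ->
  (forall y, A y -> is_derive y v f (df y)) ->
  is_derive x v df d2 ->
  (forall y, A y -> f y <= f x) ->
  df x = 0 /\ d2 <= 0.
Proof.
move=> oA Ax fdf dfd2 fx.
have ct : {for (0 : R), continuous (fun t : R => t *: v + x)}.
  move=> ?; apply: cvgD; last exact: cvg_cst.
  by apply: cvgZ; [exact: cvg_id | exact: cvg_cst].
have : \forall t \near (0 : R), A (t *: v + x).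
  by apply: ct; rewrite scale0r add0r; exact: open_nbhs_nbhs.
move=> [e /= e0 eA].
have {}eA (t : R) : `|t| < e -> A (t *: v + x).
  by move=> te; apply: eA; rewrite /ball_ /= sub0r normrN.
have := @second_derivative_test _ (fun t => f (t *: v + x))
  (fun t => df (t *: v + x)) e d2 e0.
rewrite scale0r add0r; apply.
- by move=> t te; apply/(is_derive_line f); apply: fdf; exact: eA.
- by apply/(is_derive_line df x v 0); rewrite scale0r add0r.
- by move=> t te; apply: fx; exact: eA.
Qed.

(** * Functions with first and second pure partial derivatives *)

(** The mixed partial derivatives are left out, since neither the Laplacian nor
    the second-derivative test along the axes sees them. *)
Definition has_pure_partials (R : realType) (n : nat) (A : set 'rV[R]_n)
    (f : 'rV[R]_n -> R) (df d2f : 'I_n -> 'rV[R]_n -> R) : Prop :=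
  forall i x, A x ->
    is_derive x (delta_mx 0 i) f (df i x) /\
    is_derive x (delta_mx 0 i) (df i) (d2f i x).

Lemma class_C2_pure_partials (R : realType) (n : nat) (A : set 'rV[R]_n)
    (f : 'rV[R]_n -> R) :
  class_C 2 A f ->
  has_pure_partials A f (fun i => partial i f)
    (fun i => partial i (partial i f)).
Proof.
move=> [_ fC] i x Ax; have [df [_ dfC]] := fC i.
split; first by apply: derivableP; exact: df.
by apply: derivableP; have [+ _] := dfC i; apply.
Qed.

Lemma is_derive_exp_coord (R : realType) (n : nat) (lam : R) (i0 : 'I_n)
    (x v : 'rV[R]_n) :
  is_derive x v (fun y : 'rV[R]_n => expR (lam * y 0 i0))
    (lam * v 0 i0 * expR (lam * x 0 i0)).
Proof.
rewrite -[x in is_derive x]add0r -(scale0r v).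
apply/(is_derive_line (fun y : 'rV[R]_n => expR (lam * y 0 i0)) x v 0).
have -> : (fun t : R => expR (lam * (t *: v + x) 0 i0)) =
          expR \o (fun t : R => (lam * v 0 i0) *: t + lam * x 0 i0).
  by apply/funext => t /=; rewrite !mxE /GRing.scale /=; congr expR; ring.
rewrite [X in is_derive _ _ _ X]mulrC; apply: is_derive1_comp.
  by rewrite /= scaler0 add0r; exact: is_derive_expR.
apply: is_derive_eq.
by rewrite addr0 [_ *: _]mulr1.
Qed.

Lemma has_pure_partials_sum (R : realType) (n m : nat) (A : set 'rV[R]_n)
    (c : 'I_m -> R) (f : 'I_m -> 'rV[R]_n -> R)
    (df d2f : 'I_m -> 'I_n -> 'rV[R]_n -> R) :
  (forall k, has_pure_partials A (f k) (df k) (d2f k)) ->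
  has_pure_partials A (fun x => \sum_k c k * f k x)
    (fun i x => \sum_k c k * df k i x) (fun i x => \sum_k c k * d2f k i x).
Proof.
have D (g dg : 'I_m -> 'rV[R]_n -> R) (x v : 'rV[R]_n) :
    (forall k, is_derive x v (g k) (dg k x)) ->
    is_derive x v (fun y => \sum_k c k * g k y) (\sum_k c k * dg k x).
  move=> gD; have -> : (fun y => \sum_k c k * g k y) = \sum_k (c k \*: g k).
    by apply/funext => y; rewrite fct_sumE.
  by apply: is_derive_sum => k; exact: is_deriveZ.
move=> fD i x Ax; split; apply: (D _ (fun k => _ k i)) => k.
  by have [] := fD k i x Ax.
by have [] := fD k i x Ax.
Qed.

Lemma has_pure_partials_addZ (R : realType) (n : nat) (A : set 'rV[R]_n)
    (e : R) (f g : 'rV[R]_n -> R) (df d2f dg d2g : 'I_n -> 'rV[R]_n -> R) :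
  has_pure_partials A f df d2f -> has_pure_partials A g dg d2g ->
  has_pure_partials A (fun x => f x + e * g x)
    (fun i x => df i x + e * dg i x) (fun i x => d2f i x + e * d2g i x).
Proof.
move=> fD gD i x Ax; have [f1 f2] := fD i x Ax; have [g1 g2] := gD i x Ax.
by split; apply: is_deriveD => //; exact: is_deriveZ.
Qed.

Lemma has_pure_partials_exp_barrier (R : realType) (n : nat)
    (A : set 'rV[R]_n) (lam K : R) (i0 : 'I_n) :
  has_pure_partials A (fun x => expR (lam * x 0 i0) - K)
    (fun i x => lam * (i == i0)%:R * expR (lam * x 0 i0))
    (fun i x => lam * (i == i0)%:R *
                (lam * (i == i0)%:R * expR (lam * x 0 i0))).
Proof.
move=> i x _.
have E : lam * (i == i0)%:R = lam * (delta_mx 0 i : 'rV[R]_n) 0 i0.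
  by rewrite mxE eqxx eq_sym.
rewrite E; have Dexp := is_derive_exp_coord lam i0 x (delta_mx 0 i).
split; last exact: is_deriveZ.
by rewrite -[X in is_derive _ _ _ X]subr0; apply: is_deriveB.
Qed.

(** * Maximum principle for weakly coupled cooperative systems *)

(** Replacing each off-diagonal y_k by the larger y_j can only increase the sum,
    as the corresponding coefficients are nonnegative; what remains is y_j times
    a nonpositive row sum. *)
Lemma cooperative_row_le0 (R : realType) (m : nat) (H : 'M[R]_m) (j : 'I_m)
    (y : 'I_m -> R) :
  cooperative H -> 0 <= y j -> (forall k, y k <= y j) ->
  \sum_k H j k * y k <= 0.
Proof.
move=> [Hoff Hrow] yj0 ymax.
apply: (@le_trans _ _ (\sum_k H j k * y j)); last first.
  by rewrite -mulr_suml mulr_le0_ge0.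
apply: ler_sum => k _; have [->//|kj] := eqVneq k j.
by apply: ler_wpM2l => //; apply: Hoff; rewrite eq_sym.
Qed.

Lemma bounded_closure_compact (R : realType) (n : nat) (A : set 'rV[R]_n) :
  bounded_set A -> compact (closure A).
Proof.
move=> [M [_ AM]]; apply: bounded_closed_compact; last exact: closed_closure.
exists M; split; first by rewrite num_real.
move=> N MN /= x Ax.
have cN : closed [set y : 'rV[R]_n | `|y| <= N].
  apply: (@closed_comp _ _ (fun y : 'rV[R]_n => `|y|) [set r | r <= N]).
    by move=> y _; exact: norm_continuous.
  exact: closed_le.
by apply: cN; apply: closure_subset Ax => y /= Ay; apply: AM.
Qed.

Lemma exists_joint_maximum (R : realType) (T : topologicalType) (m : nat)
    (K : set T) (w : 'I_m -> T -> R) (j0 : 'I_m) (x0 : T) :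
  compact K -> K x0 -> (forall j, {within K, continuous (w j)}) ->
  exists j x, K x /\ forall k y, K y -> w k y <= w j x.
Proof.
move=> cK Kx0 wc.
have /choice[z zP] k : exists c, K c /\ forall y, K y -> w k y <= w k c.
  have [|c] := compact_EVT_max _ cK (wc k); first by exists x0.
  rewrite inE => Kc cmax; exists c; split=> // y Ky.
  by apply: cmax; rewrite inE.
have [j _ jmax] := arg_maxP (fun k => w k (z k)) (erefl (predT j0)).
exists j, (z j); split; first by have [] := zP j.
by move=> k y Ky; apply: le_trans (jmax k isT); have [_] := zP k; apply.
Qed.

(** A positive joint maximum over components and points is attained inside A,
    where each of the three sums is nonpositive: the first by the second
    derivative test, the second because the gradient vanishes, the third by
    [cooperative_row_le0]. *)
Lemma strict_cooperative_maximum_principle (R : realType) (n m : nat)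
    (A : set 'rV[R]_n) (H : 'M[R]_m) (beta : 'I_n -> 'rV[R]_m)
    (w : 'I_m -> 'rV[R]_n -> R) (dw d2w : 'I_m -> 'I_n -> 'rV[R]_n -> R) :
  bounded_set A -> open A -> cooperative H ->
  (forall j, {within closure A, continuous (w j)}) ->
  (forall j, has_pure_partials A (w j) (dw j) (d2w j)) ->
  (forall j x, A x -> 0 < \sum_i d2w j i x + \sum_i beta i 0 j * dw j i x
                          + \sum_k H j k * w k x) ->
  (forall j x, boundary A x -> w j x <= 0) ->
  forall j x, A x -> w j x <= 0.
Proof.
move=> bA oA coopH wc wD wL wbd j0 x0 Ax0; rewrite leNgt; apply/negP => w0.
have [j [x [clAx wmax]]] := exists_joint_maximum j0
  (bounded_closure_compact bA) (subset_closure Ax0) wc.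
have wjx0 : 0 < w j x.
  by apply: lt_le_trans w0 _; apply: wmax; exact: subset_closure.
have Ax : A x.
  apply: contrapT => nAx; have := wbd j x; rewrite leNgt wjx0.
  move=> h; suff: false by [].
  by apply: h; split=> //; rewrite (interior_id A).1.
have test i : dw j i x = 0 /\ d2w j i x <= 0.
  apply: (directional_second_derivative_test (f := w j) (v := delta_mx 0 i)
    oA Ax).
  - by move=> y Ay; have [] := wD j i y Ay.
  - by have [] := wD j i x Ax.
  - by move=> y Ay; apply: wmax; exact: subset_closure.
have := wL j x Ax; rewrite ltNge => /negP; apply.
rewrite [X in _ + X + _]big1 ?addr0; last first.
  by move=> i _; rewrite (test i).1 mulr0.
rewrite -[leRHS]addr0 lerD //.
  by apply: sumr_le0 => i _; exact: (test i).2.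
apply: cooperative_row_le0 => //; first exact: ltW.
by move=> k; apply: wmax.
Qed.

(** The barrier is built on the first coordinate only: a single direction
    suffices to make the perturbed inequality strict, and this is where
    the dimension has to be positive. *)
Lemma cooperative_maximum_principle (R : realType) (n m : nat)
    (A : set 'rV[R]_n) (H : 'M[R]_m) (beta : 'I_n -> 'rV[R]_m)
    (v : 'I_m -> 'rV[R]_n -> R) (dv d2v : 'I_m -> 'I_n -> 'rV[R]_n -> R) :
  (0 < n)%N -> bounded_set A -> open A -> cooperative H ->
  (forall j, {within closure A, continuous (v j)}) ->
  (forall j, has_pure_partials A (v j) (dv j) (d2v j)) ->
  (forall j x, A x -> 0 <= \sum_i d2v j i x + \sum_i beta i 0 j * dv j i x
                          + \sum_k H j k * v k x) ->
  (forall j x, boundary A x -> v j x <= 0) ->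
  forall j x, A x -> v j x <= 0.
Proof.
move=> n_gt0 bA oA coopH vc vD vL vbd j0 x0 Ax0.
pose i0 := Ordinal n_gt0.
(* lam exceeds every |beta^(0)_j|, which makes lam (lam + beta^(0)_j) > 0
   uniformly in j. *)
pose lam : R := 1 + \sum_j `|beta i0 0 j|.
have lam_gt0 : 0 < lam by rewrite ltr_pwDl// sumr_ge0.
have lam_beta j : 0 < lam + beta i0 0 j.
  rewrite /lam (bigD1 j)//=; have := ler_norm (- beta i0 0 j); rewrite normrN.
  have : 0 <= \sum_(k < m | k != j) `|beta i0 0 k| by rewrite sumr_ge0.
  lra.
pose phi (x : 'rV[R]_n) := expR (lam * x 0 i0).
have phic : continuous phi.
  move=> x; apply: continuous_comp; last exact: continuous_expR.
  apply: continuousM; last exact: coord_continuous.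
  exact: cst_continuous.
(* The joint maximum of a family constant in its index is a maximum of phi. *)
have [_ [z [_ zmax]]] := exists_joint_maximum (w := fun=> phi) j0
  (bounded_closure_compact bA) (subset_closure Ax0)
  (fun=> continuous_subspaceT phic).
pose K := phi z.
have phiK x : closure A x -> phi x <= K by exact: zmax j0 x.
suff perturbed e : 0 < e -> v j0 x0 + e * (phi x0 - K) <= 0.
  apply/ler_addgt0Pr => e e0.
  (* The extra 1 keeps the denominator positive when phi x0 = K. *)
  have d0 : 0 < K - phi x0 + 1.
    by have := phiK _ (subset_closure Ax0); lra.
  have := perturbed (e / (K - phi x0 + 1)) (divr_gt0 e0 d0).
  rewrite mulrAC -mulrA -opprB mulNr.
  have : (K - phi x0) / (K - phi x0 + 1) <= 1 by rewrite ler_pdivrMr//; lra.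
  move=> /(ler_wpM2l (ltW e0)); lra.
move=> e0; pose w j x := v j x + e * (phi x - K).
pose dphi i x := lam * (i == i0)%:R * phi x.
pose d2phi i x := lam * (i == i0)%:R * dphi i x.
have wD j : has_pure_partials A (w j) (fun i x => dv j i x + e * dphi i x)
    (fun i x => d2v j i x + e * d2phi i x).
  by apply: has_pure_partials_addZ => //; exact: has_pure_partials_exp_barrier.
suff : forall j x, A x -> w j x <= 0 by exact.
apply: (strict_cooperative_maximum_principle (beta := beta) bA oA coopH _ wD).
- have ephiK : continuous (fun x => e * (phi x - K)).
    by move=> x; exact: (cvgM (cvg_cst e) (cvgB (phic x) (cvg_cst K))).
  move=> j x; apply: cvgD; first exact: vc.
  exact: (continuous_subspaceT ephiK).
- move=> j x Ax.
  have S1 : \sum_i (d2v j i x + e * d2phi i x) =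
      \sum_i d2v j i x + e * (lam * lam * phi x).
    rewrite big_split/=; congr (_ + _); rewrite (bigD1 i0)//= big1 => [|i].
      by rewrite /d2phi /dphi eqxx /=; ring.
    by move/negbTE => i_neq; rewrite /d2phi /dphi i_neq /=; ring.
  have S2 : \sum_i beta i 0 j * (dv j i x + e * dphi i x) =
      \sum_i beta i 0 j * dv j i x + e * (beta i0 0 j * lam * phi x).
    under eq_bigr do rewrite mulrDr.
    rewrite big_split/=; congr (_ + _); rewrite (bigD1 i0)//= big1 => [|i].
      by rewrite /dphi eqxx /=; ring.
    by move/negbTE => i_neq; rewrite /dphi i_neq /=; ring.
  have S3 : \sum_k H j k * w k x =
      \sum_k H j k * v k x + (\sum_k H j k) * (e * (phi x - K)).
    by under eq_bigr do rewrite mulrDr; rewrite big_split/= mulr_suml.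
  rewrite S1 S2 S3.
  have T1 : 0 <= (\sum_k H j k) * (e * (phi x - K)).
    apply: mulr_le0; first exact: coopH.2.
    by rewrite pmulr_rle0// subr_le0; exact/phiK/subset_closure.
  have T2 : 0 < e * (lam * (lam + beta i0 0 j) * phi x).
    by rewrite !mulr_gt0// expR_gt0.
  have := vL j x Ax; move: T1 T2.
  have -> : e * (lam * (lam + beta i0 0 j) * phi x) =
      e * (lam * lam * phi x) + e * (beta i0 0 j * lam * phi x) by ring.
  lra.
- move=> j x bx; rewrite -[leRHS]addr0 lerD//; first exact: vbd.
  by rewrite pmulr_rle0// subr_le0; apply: phiK; case: bx.
Qed.

(** * Diagonalization of the system *)

(** Inserting Q P = 1 in front of each Du i and of u expresses the system in the
    unknown P u, whose first-order part is then diagonal. *)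
Lemma conjugated_system (R : realType) (n m : nat) (P Q C : 'M[R]_m)
    (B : 'I_n -> 'M[R]_m) (beta : 'I_n -> 'rV[R]_m)
    (Lap u : 'cV[R]_m) (Du : 'I_n -> 'cV[R]_m) :
  Q *m P = 1%:M -> (forall i, P *m B i *m Q = diag_mx (beta i)) ->
  P *m (Lap + \sum_i B i *m Du i + C *m u) =
  P *m Lap + \sum_i diag_mx (beta i) *m (P *m Du i)
  + (P *m C *m Q) *m (P *m u).
Proof.
move=> QP BP; rewrite !mulmxDr mulmx_sumr; congr (_ + _ + _).
  apply: eq_bigr => i _; rewrite -BP -!mulmxA.
  by rewrite [Q *m _]mulmxA QP mul1mx.
by rewrite -!mulmxA [Q *m _]mulmxA QP mul1mx.
Qed.

Theorem theorem3 (R : realType) (n m : nat) (n_gt0 : (0 < n)%N)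
    (Omega : set 'rV[R]_n) (Omega_bounded : bounded_set Omega)
    (Omega_open : open Omega)
    (B : 'I_n -> 'M[R]_m) (C Q : 'M[R]_m) (Q_unit : Q \in unitmx)
    (B_diag : forall i : 'I_n,
       exists beta : 'rV[R]_m, invmx Q *m B i *m Q = diag_mx beta)
    (Qinv_ge0 : mxle 0 (invmx Q))
    (C_coop : cooperative (invmx Q *m C *m Q)) :
  invariant_set Omega (solves_system Omega B C)
    [set v : 'cV[R]_m | mxle (invmx Q *m v) 0].
Proof.
have [beta betaE] := choice B_diag.
move=> u uC2 uc usys ubd x Ox j j'; rewrite ord1 {j'} [leRHS]mxE.
have vE y k : (invmx Q *m u y) k 0 = \sum_l invmx Q k l * vcomp u l y.
  by rewrite mxE.
rewrite vE; move: j x Ox.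
apply: (cooperative_maximum_principle (beta := beta) n_gt0 Omega_bounded
  Omega_open C_coop _ (fun j => has_pure_partials_sum (invmx Q j)
    (fun k => class_C2_pure_partials (uC2 k)))).
- move=> j x; apply: (cvg_big add_continuous) => k _.
  exact: (cvgM (cvg_cst (invmx Q j k)) (uc k x)).
- move=> j x Ox.
  pose F := vlaplacian u x + \sum_i B i *m vpartial i u x + C *m u x.
  have : 0 <= (invmx Q *m F) j 0.
    rewrite mxE sumr_ge0// => k _; apply: mulr_ge0.
      by have := Qinv_ge0 j k; rewrite mxE.
    by have := usys x Ox k 0; rewrite [X in X <= _]mxE.
  rewrite (conjugated_system _ _ _ _ (mulmxV Q_unit) betaE).
  congr (0 <= _); rewrite mxE [in LHS]mxE; congr (_ + _ + _).
  + rewrite mxE exchange_big/=; apply: eq_bigr => k _.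
    by rewrite mxE mulr_sumr.
  + rewrite summxE; apply: eq_bigr => i _.
    rewrite mul_diag_mx !mxE; congr (_ * _).
    by apply: eq_bigr => k _; rewrite mxE.
  + by rewrite mxE; apply: eq_bigr => k _; rewrite vE.
- by move=> j x bx; have := ubd x bx j 0; rewrite vE [X in _ <= X]mxE.
Qed.
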